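(* Given a $\rho$-approximation algorithm for (metric) uncapacitated facility location (UFL), and a $\gamma$-approximation algorithm for uniform MLUFL with zero facility costs (and metric connection costs), one can obtain a $(\rho+2\gamma)$-approximation algorithm for metric uniform MLUFL.
   Context: Uniform MLUFL: we are given a set $\mathcal F$ of $n$ facilities with opening costs $f_i\ge 0$, a set $\mathcal D$ of clients, connection costs $c_{ij}\ge0$ ($i\in\mathcal F$, $j\in\mathcal D$), and a root $r$, with the uniform time metric $d_{uv}=1$ for all distinct $u,v\in\mathcal F\cup\{r\}$. A solution opens a set $F\subseteq\mathcal F$, orders $F$ (a path from $r$ through $F$), and assigns each client $j$ to some $\phi(j)\in F$; its cost is $\sum_{i\in F}f_i+\sum_j\bigl(c_{\phi(j)j}+\pi(\phi(j))\bigr)$, where $\pi(i)\in\{1,2,\dots\}$ is the position of $i$ in the ordering. It is called metric uniform MLUFL when the connection costs come from a metric $c$ on $\mathcal F\cup\mathcal D$. The zero-facility-cost version is the case where all $f_i=0$. UFL: same input without the root and time metric; choose $F\subseteq\mathcal F$ and $\phi:\mathcal D\to F$ to minimize $\sum_{i\in F}f_i+\sum_jc_{\phi(j)j}$; metric UFL is the case where $c$ comes from a metric on $\mathcal F\cup\mathcal D$. An $\alpha$-approximation algorithm is a polynomial-time algorithm returning a feasible solution of cost at most $\alpha$ times the cost of an optimal (integer) solution. *)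

(* Defs.v *)
From HB Require Import structures.
From mathcomp Require Import all_boot all_order all_algebra.

Set Implicit Arguments.
Unset Strict Implicit.
Unset Printing Implicit Defensive.

Import Order.TTheory GRing.Theory Num.Theory.
Local Open Scope ring_scope.

(* Algorithms are programs of a while-language over binary trees whose leaves *)
(* are rational numbers.  Time is bit-cost: each elementary step is charged   *)
(* the bit-size of the tree it reads, so running times agree, up to a         *)
(* polynomial, with those of Turing machines.                                 *)

Inductive data := Leaf of rat | Node of data & data.

Definition bitlen (n : nat) : nat := (trunc_log 2 n).+1.

Fixpoint dsize (x : data) : nat :=
  match x with
  | Leaf q => (bitlen `|numq q|%N + bitlen `|denq q|%N)%N
  | Node a b => (dsize a + dsize b).+1
  end.

Inductive prim :=
  | PId | PFst | PSnd | PConst of rat | PIsNode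
  | PAdd | POpp | PMul | PInv | PFloor | PLe.

Definition dbool (b : bool) : data := Leaf (b%:R).

(* Leaf 0 stands for false (and for the empty list), anything else for true.  *)
Definition truthy (x : data) : bool := if x is Leaf q then q != 0 else true.

(* Ill-typed arguments yield Leaf 0.                                          *)
Definition prim_eval (o : prim) (x : data) : data :=
  match o, x with
  | PId, _ => x
  | PFst, Node a _ => a
  | PSnd, Node _ b => b
  | PConst q, _ => Leaf q
  | PIsNode, Node _ _ => dbool true
  | PAdd, Node (Leaf p) (Leaf q) => Leaf (p + q)
  | POpp, Leaf q => Leaf (- q)
  | PMul, Node (Leaf p) (Leaf q) => Leaf (p * q)
  | PInv, Leaf q => Leaf q^-1
  | PFloor, Leaf q => Leaf (Num.floor q)%:~R
  | PLe, Node (Leaf p) (Leaf q) => dbool (p <= q)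
  | _, _ => Leaf 0
  end.

Inductive prog :=
  | Prim of prim
  | Seq of prog & prog
  | Pair of prog & prog
  | If of prog & prog & prog
  | While of prog & prog.

(* run p x y t: on input x, program p halts with output y after time t.       *)
Inductive run : prog -> data -> data -> nat -> Prop :=
  | run_prim o x : run (Prim o) x (prim_eval o x) (dsize x)
  | run_seq p q x y z t1 t2 :
      run p x y t1 -> run q y z t2 -> run (Seq p q) x z (t1 + t2)
  | run_pair p q x y z t1 t2 :
      run p x y t1 -> run q x z t2 ->
      run (Pair p q) x (Node y z) (dsize x + t1 + t2)
  | run_if p q r x b y t1 t2 :
      run p x b t1 -> run (if truthy b then q else r) x y t2 ->
      run (If p q r) x y (dsize x + t1 + t2)
  | run_while_stop p q x b t1 :
      run p x b t1 -> ~~ truthy b ->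
      run (While p q) x x (dsize x + t1)
  | run_while_step p q x b y z t1 t2 t3 :
      run p x b t1 -> truthy b -> run q x y t2 -> run (While p q) y z t3 ->
      run (While p q) x z (dsize x + t1 + t2 + t3).

Lemma run_det p x y1 y2 t1 t2 :
  run p x y1 t1 -> run p x y2 t2 -> y1 = y2 /\ t1 = t2.
Proof.
have contra b : truthy b -> ~~ truthy b -> False by move=> ->.
have step q u v1 v2 s1 s2 (IH : forall v s, run q u v s -> v1 = v /\ s1 = s) :
  run q u v2 s2 -> v2 = v1 /\ s2 = s1 by move=> /IH [-> ->].
move=> r1; elim: r1 y2 t2 => {p x y1 t1}.
- by move=> o x y' t' r2; inversion r2.
- move=> p q x y z t1 t2 _ /step IH1 _ /step IH2 y' t' r2; inversion r2; subst.
  by case: (IH1 _ _ ltac:(eassumption)) => ? ?; subst;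
     case: (IH2 _ _ ltac:(eassumption)) => -> ->.
- move=> p q x y z t1 t2 _ /step IH1 _ /step IH2 y' t' r2; inversion r2; subst.
  by case: (IH1 _ _ ltac:(eassumption)) => -> ->;
     case: (IH2 _ _ ltac:(eassumption)) => -> ->.
- move=> p q r x b y t1 t2 _ /step IH1 _ /step IH2 y' t' r2; inversion r2; subst.
  by case: (IH1 _ _ ltac:(eassumption)) => ? ?; subst;
     case: (IH2 _ _ ltac:(eassumption)) => -> ->.
- move=> p q x b t1 _ /step IH1 nb y' t' r2; inversion r2; subst.
    by case: (IH1 _ _ ltac:(eassumption)) => _ ->.
  by case: (IH1 _ _ ltac:(eassumption)) => ? ?; subst; case: (contra b).
- move=> p q x b y z t1 t2 t3 _ /step IH1 tb _ /step IH2 _ /step IH3 y' t' r2.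
  inversion r2; subst.
    by case: (IH1 _ _ ltac:(eassumption)) => ? ?; subst; case: (contra b).
  case: (IH1 _ _ ltac:(eassumption)) => ? ?; subst.
  case: (IH2 _ _ ltac:(eassumption)) => ? ?; subst.
  by case: (IH3 _ _ ltac:(eassumption)) => -> ->.
Qed.

Fixpoint dlist (s : seq data) : data :=
  if s is x :: s' then Node x (dlist s') else Leaf 0.

Definition dnat (n : nat) : data := Leaf n%:R.

(* The root and the uniform time metric carry no information, so UFL and      *)
(* uniform MLUFL have the same inputs.  Costs are rational, being part of the *)
(* input of an algorithm.                                                     *)
Record instance := Instance {
  nfac : nat;
  ncli : nat;
  fcost : 'I_nfac -> rat;
  ccost : 'I_nfac -> 'I_ncli -> rat;
  fcost_ge0 : forall i, 0 <= fcost i;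
  ccost_ge0 : forall i j, 0 <= ccost i j
}.

Definition enc_instance (I : instance) : data :=
  Node (dlist [seq Leaf (fcost i) | i <- enum 'I_(nfac I)])
       (dlist [seq dlist [seq Leaf (ccost i j) | i <- enum 'I_(nfac I)]
                 | j <- enum 'I_(ncli I)]).

(* As usual in facility location, distinct points may be at distance 0.       *)
Definition is_metric (T : Type) (d : T -> T -> rat) : Prop :=
  [/\ forall x y, 0 <= d x y,
      forall x, d x x = 0,
      forall x y, d x y = d y x
    & forall x y z, d x z <= d x y + d y z].

Definition metric_instance (I : instance) : Prop :=
  exists2 d : 'I_(nfac I) + 'I_(ncli I) -> 'I_(nfac I) + 'I_(ncli I) -> rat,
    is_metric d & forall i j, d (inl i) (inr j) = ccost i j.

Definition zero_facility_costs (I : instance) : Prop :=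
  forall i : 'I_(nfac I), fcost i = 0.

Record problem := Problem {
  solution : instance -> Type;
  feasible : forall I, solution I -> Prop;
  cost : forall I, solution I -> rat;
  enc_solution : forall I, solution I -> data
}.

Definition dassign (n m : nat) (phi : 'I_m -> 'I_n) : data :=
  dlist [seq dnat (phi j) | j <- enum 'I_m].

Record ufl_solution (I : instance) := UflSolution {
  ufl_open : {set 'I_(nfac I)};
  ufl_assign : 'I_(ncli I) -> 'I_(nfac I)
}.

Definition UFL : problem := {|
  solution := ufl_solution;
  feasible := fun I S => forall j, ufl_assign S j \in ufl_open S;
  cost := fun I S =>
    \sum_(i in ufl_open S) fcost i + \sum_j ccost (ufl_assign S j) j;
  enc_solution := fun I S =>
    Node (dlist [seq dnat i | i : 'I_(nfac I) <- enum (ufl_open S)]) (dassign (ufl_assign S))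
|}.

(* The path lists the open facilities in the order in which they are visited. *)
Record mlufl_solution (I : instance) := MluflSolution {
  mlufl_path : seq 'I_(nfac I);
  mlufl_assign : 'I_(ncli I) -> 'I_(nfac I)
}.

Definition position (T : eqType) (s : seq T) (x : T) : nat := (index x s).+1.

Definition uniform_MLUFL : problem := {|
  solution := mlufl_solution;
  feasible := fun I S =>
    uniq (mlufl_path S) /\ forall j, mlufl_assign S j \in mlufl_path S;
  cost := fun I S =>
    \sum_(i <- mlufl_path S) fcost i +
    \sum_j (ccost (mlufl_assign S j) j +
            (position (mlufl_path S) (mlufl_assign S j))%:R);
  enc_solution := fun I S =>
    Node (dlist [seq dnat i | i : 'I_(nfac I) <- mlufl_path S]) (dassign (mlufl_assign S))
|}.

Definition optimal (P : problem) (I : instance) (S : solution P I) : Prop :=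
  feasible S /\ forall S' : solution P I, feasible S' -> cost S <= cost S'.

(* The approximation guarantee is required whenever an optimal solution       *)
(* exists, i.e. unless there are clients but no facilities.                   *)
Definition approx_algorithm (R : realFieldType) (P : problem)
    (C : instance -> Prop) (alpha : R) (A : prog) : Prop :=
  exists b : {poly nat}, forall I : instance, C I ->
    exists y t,
      [/\ run A (enc_instance I) y t,
          (t <= b.[dsize (enc_instance I)])%N
        & forall S0 : solution P I, optimal S0 ->
            exists S : solution P I,
              [/\ y = enc_solution S, feasible S
                & ratr (cost S) <= alpha * ratr (cost S0)]].

(* Main.v *)
Require Import Defs.
From mathcomp Require Import all_boot all_order all_algebra zify lra.

Set Implicit Arguments.
Unset Strict Implicit.
Unset Printing Implicit Defensive.

Import Order.TTheory GRing.Theory Num.Theory.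

(* Run the UFL algorithm on the input, giving an assignment phi1, and the     *)
(* MLUFL algorithm on the input with zero facility costs, giving a path and   *)
(* an assignment phi2.  Replace each facility i of the path by                *)
(* sigma(i) = phi1(k), where the client k minimizes c(phi1(k), k) + c(i, k),  *)
(* keep first occurrences only, and assign j to sigma(phi2(j)).  Positions do *)
(* not increase, only facilities opened by the UFL solution are used, and     *)
(* c(sigma(phi2(j)), j) <= c(phi1(j), j) + 2 c(phi2(j), j) by the triangle    *)
(* inequality.  That this runs in polynomial time follows from closure of the *)
(* polynomial-time functions on trees under composition, branching and folds  *)
(* over lists whose accumulators stay of polynomial size.                     *)

(** * Polynomial-time functions on trees *)

(** Let OPT be the optimal cost of the given instance. Forgetting the order of a path turns an MLUFL
    solution into a UFL solution that is no more expensive ([ufl_le_mlufl]), and dropping facility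
    costs only lowers the cost ([mlufl_zero_le]). Hence the two given algorithms return S1 of cost
    at most rho OPT and S2 of cost at most gamma OPT.

    The combined solution pays facility costs out of S1 and latencies out of S2, because every
    facility i of the path moves to one that S1 uses and positions do not grow
    ([position_first_images]). The price is a detour phi1(k), k, i, j for a client j with i =
    phi2(j). By the choice of k its first two legs cost at most c(phi1(j), j) + c(i, j)
    ([ccost_nearby]). So the total is at most cost S1 + 2 cost S2 ([combined_cost]).

    On the computational side, [ptime_fold] gives polynomial-time list programs, and [dcombineE]
    identifies the output of the combining program with the combined solution. Two points make the
    guarantees usable: optima of both subproblems exist by finiteness ([ufl_optimal_exists],
    [mlufl_optimal_exists]), and the ratios are nonnegative ([approx_ratio_ge0]), so that they can
    multiply the comparisons with OPT. *)

Definition poly_bounded (g : nat -> nat) : Prop :=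
  exists b : {poly nat}, forall n, g n <= b.[n]%R.

Lemma leq_horner (b : {poly nat}) m n : m <= n -> b.[m]%R <= b.[n]%R.
Proof.
move=> le_mn; elim/poly_ind: b => [|b c IH]; first by rewrite !horner0.
by rewrite !hornerE leq_add2r leq_mul.
Qed.

Lemma poly_bounded_const c : poly_bounded (fun=> c).
Proof. by exists c%:P%R => n; rewrite hornerC. Qed.

Lemma poly_bounded_id : poly_bounded id.
Proof. by exists 'X%R => n; rewrite hornerX. Qed.

Lemma poly_boundedD g h :
  poly_bounded g -> poly_bounded h -> poly_bounded (fun n => g n + h n).
Proof.
move=> [b gb] [c hc]; exists (b + c)%R => n.
by rewrite hornerD leq_add.
Qed.

Lemma poly_boundedM g h :
  poly_bounded g -> poly_bounded h -> poly_bounded (fun n => g n * h n).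
Proof.
move=> [b gb] [c hc]; exists (b * c)%R => n.
by rewrite hornerM leq_mul.
Qed.

Lemma poly_bounded_horner (b : {poly nat}) g :
  poly_bounded g -> poly_bounded (fun n => b.[g n]%R).
Proof.
move=> [c gc]; exists (b \Po c)%R => n.
by rewrite horner_comp leq_horner.
Qed.

Ltac poly_bounded := repeat first
  [ exact: poly_bounded_const | exact: poly_bounded_id | apply: poly_boundedD
  | apply: poly_boundedM | apply: poly_bounded_horner ].

(** Output size is bounded together with time, since it is what bounds the input of the next program
    in a composition. *)
Definition ptime (f : data -> data) : Prop :=
  exists p, exists b : {poly nat}, forall x,
    exists2 t, run p x (f x) t & t + dsize (f x) <= b.[dsize x]%R.

Lemma ptimeI f p g : poly_bounded g ->
  (forall x, exists2 t, run p x (f x) t & t + dsize (f x) <= g (dsize x)) ->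
  ptime f.
Proof.
move=> [b gb] H; exists p, b => x; have [t r le] := H x.
by exists t => //; exact: leq_trans le (gb _).
Qed.

Lemma eq_ptime f g : f =1 g -> ptime f -> ptime g.
Proof. by move=> fg [p [b H]]; exists p, b => x; rewrite -fg. Qed.

Lemma ptime_dsize f : ptime f ->
  exists b : {poly nat}, forall x, dsize (f x) <= b.[dsize x]%R.
Proof.
move=> [p [b H]]; exists b => x; have [t _] := H x.
by apply: leq_trans; exact: leq_addl.
Qed.

Lemma ptime_comp f g : ptime f -> ptime g -> ptime (fun x => f (g x)).
Proof.
move=> [pf [bf Hf]] [pg [bg Hg]].
apply: (@ptimeI _ (Seq pg pf) (fun n => bg.[n] + bf.[bg.[n]])%R).
  by poly_bounded.
move=> x; have [t r le] := Hg x; have [t' r' le'] := Hf (g x).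
exists (t + t'); first exact: run_seq r r'.
rewrite -addnA leq_add //; first by apply: leq_trans le; exact: leq_addr.
by apply: leq_trans le' _; apply: leq_horner; apply: leq_trans le; exact: leq_addl.
Qed.

Lemma ptime_pair f g : ptime f -> ptime g -> ptime (fun x => Node (f x) (g x)).
Proof.
move=> [pf [bf Hf]] [pg [bg Hg]].
apply: (@ptimeI _ (Pair pf pg) (fun n => n + bf.[n]%R + bg.[n]%R + 1)).
  by poly_bounded.
move=> x; have [t r le] := Hf x; have [t' r' le'] := Hg x.
by exists (dsize x + t + t'); [exact: run_pair r r' | rewrite /=; lia].
Qed.

Lemma ptime_if c f g : ptime c -> ptime f -> ptime g ->
  ptime (fun x => if truthy (c x) then f x else g x).
Proof.
move=> [pc [bc Hc]] [pf [bf Hf]] [pg [bg Hg]].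
apply: (@ptimeI _ (If pc pf pg)
  (fun n => n + bc.[n]%R + (bf.[n]%R + bg.[n]%R))); first by poly_bounded.
move=> x; have [t r le] := Hc x.
have [t' r' le'] : exists2 t', run (if truthy (c x) then pf else pg) x
    (if truthy (c x) then f x else g x) t' &
    t' + dsize (if truthy (c x) then f x else g x)
      <= bf.[dsize x]%R + bg.[dsize x]%R.
  case: ifP => _; [have [t' ? ?] := Hf x | have [t' ? ?] := Hg x];
    by exists t' => //; lia.
by exists (dsize x + t + t'); [exact: run_if r r' | lia].
Qed.

Lemma ptime_prim o :
  (exists2 g, poly_bounded g &
    forall x, dsize (prim_eval o x) <= g (dsize x)) -> ptime (prim_eval o).
Proof.
move=> [g gP H].
apply: (@ptimeI _ (Prim o) (fun n => n + g n)); first by poly_bounded.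
by move=> x; exists (dsize x); [exact: run_prim | rewrite leq_add2l].
Qed.

(** * Bit lengths and the size of rational sums *)

Lemma leq_bitlen m n : m <= n -> bitlen m <= bitlen n.
Proof. exact: leq_trunc_log. Qed.

Lemma bitlen_leq_exp n k : 0 < k -> n < 2 ^ k -> bitlen n <= k.
Proof.
case: n => [|n] k0 nk; first by rewrite /bitlen trunc_log0.
rewrite /bitlen -(ltn_exp2l _ _ (leqnn 2)); apply: leq_ltn_trans nk.
exact: trunc_logP.
Qed.

Lemma ltn_exp_bitlen n : n < 2 ^ bitlen n.
Proof. exact: trunc_log_ltn. Qed.

Lemma bitlenD m n : bitlen (m + n) <= bitlen m + bitlen n.
Proof.
apply: bitlen_leq_exp; first by rewrite addn_gt0.
have := ltn_exp_bitlen m; have := ltn_exp_bitlen n; rewrite expnD.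
move: (2 ^ _) (2 ^ _) => a b ha hb; nia.
Qed.

Lemma bitlenM m n : bitlen (m * n) <= bitlen m + bitlen n.
Proof.
apply: bitlen_leq_exp; first by rewrite addn_gt0.
have := ltn_exp_bitlen m; have := ltn_exp_bitlen n; rewrite expnD.
move: (2 ^ _) (2 ^ _) => a b ha hb; nia.
Qed.

Lemma bitlen_leqS n : bitlen n <= n.+1.
Proof. apply: bitlen_leq_exp => //; exact: ltn_trans (ltnSn n) (ltn_expl _ _). Qed.

Lemma dsize_ge2 x : 2 <= dsize x.
Proof.
elim: x => [q|a IHa b IHb] /=; last by lia.
by rewrite addnS.
Qed.

(** Reduction to lowest terms divides both entries by a common nonzero factor, so it can only
    shorten them; a zero denominator gives the value 0, of the least possible size. *)
Lemma dsize_Leaf_quot (n d : int) :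
  dsize (Leaf (n%:Q / d%:Q)%R) <= bitlen `|n| + bitlen `|d|.
Proof.
case: divqP => [_|k x k0]; first by rewrite /= (_ : bitlen _ + _ = 2) // /bitlen; lia.
by rewrite /= !abszM leq_add // leq_bitlen // leq_pmull // absz_gt0.
Qed.

Lemma dsize_add p q :
  dsize (Leaf (p + q)%R) <= 2 * (dsize (Leaf p) + dsize (Leaf q)).
Proof.
have -> : (p + q = (numq p * denq q + numq q * denq p)%:~R
             / (denq p * denq q)%:~R)%R.
  rewrite -{1}(divq_num_den p) -{1}(divq_num_den q) rmorphD !rmorphM /=.
  by rewrite addf_div ?intr_eq0 ?denq_eq0.
apply: leq_trans (dsize_Leaf_quot _ _) _ => /=; rewrite abszM.
set a := absz (numq p); set b := absz (numq q).
set c := absz (denq p); set d := absz (denq q).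
have le1 : absz (numq p * denq q + numq q * denq p)%R <= a * d + b * c.
  by rewrite /a /b /c /d -!abszM; lia.
have := leq_bitlen le1; have := bitlenD (a * d) (b * c).
have := bitlenM a d; have := bitlenM b c; have := bitlenM c d; lia.
Qed.

(** * Primitive operations in polynomial time *)

Definition dfst (x : data) : data := if x is Node a _ then a else Leaf 0.
Definition dsnd (x : data) : data := if x is Node _ b then b else Leaf 0.
Definition disnode (x : data) : data := prim_eval PIsNode x.
Definition dadd (x y : data) : data := prim_eval PAdd (Node x y).
Definition dle (x y : data) : data := prim_eval PLe (Node x y).

Lemma dsize_bool b : dsize (dbool b) = 2. Proof. by case: b. Qed.

Lemma dsize_fst_snd x : dsize (dfst x) + dsize (dsnd x) <= dsize x + 2.
Proof.
case: x => [q|a b]; last by rewrite /=; lia.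
by rewrite addnC leq_add2r; exact: (dsize_ge2 (Leaf q)).
Qed.

Lemma dsize_fst x : dsize (dfst x) <= dsize x.
Proof. have := dsize_fst_snd x; have := dsize_ge2 (dsnd x); lia. Qed.

Lemma dsize_snd x : dsize (dsnd x) <= dsize x.
Proof. have := dsize_fst_snd x; have := dsize_ge2 (dfst x); lia. Qed.

Lemma ptime_id : ptime id.
Proof. by apply: (@ptime_prim PId); exists id => //; poly_bounded. Qed.

Lemma ptime_fst f : ptime f -> ptime (fun x => dfst (f x)).
Proof.
apply: ptime_comp; apply: (@ptime_prim PFst).
by exists id; [poly_bounded | exact: dsize_fst].
Qed.

Lemma ptime_snd f : ptime f -> ptime (fun x => dsnd (f x)).
Proof.
apply: ptime_comp; apply: (@ptime_prim PSnd).
by exists id; [poly_bounded | exact: dsize_snd].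
Qed.

Lemma ptime_leaf q : ptime (fun=> Leaf q).
Proof.
by apply: (@ptime_prim (PConst q)); exists (fun=> dsize (Leaf q)) => //; poly_bounded.
Qed.

Lemma ptime_isnode f : ptime f -> ptime (fun x => disnode (f x)).
Proof.
apply: ptime_comp; apply: (@ptime_prim PIsNode).
by exists (fun=> 2); [poly_bounded | case].
Qed.

Lemma ptime_add f g : ptime f -> ptime g -> ptime (fun x => dadd (f x) (g x)).
Proof.
move=> pf pg; rewrite /dadd; apply: (ptime_comp _ (ptime_pair pf pg)).
apply: (@ptime_prim PAdd); exists (fun n => 2 * n); first by poly_bounded.
have two x : dsize (Leaf 0) <= 2 * dsize x by apply: leq_trans (dsize_ge2 x) _; rewrite leq_pmull.
case=> [q|[p|a b] [q|c d]]; try exact: two.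
by apply: leq_trans (dsize_add p q) _; rewrite leq_mul2l /=.
Qed.

Lemma ptime_le f g : ptime f -> ptime g -> ptime (fun x => dle (f x) (g x)).
Proof.
move=> pf pg; rewrite /dle; apply: (ptime_comp _ (ptime_pair pf pg)).
apply: (@ptime_prim PLe); exists (fun=> 2); first by poly_bounded.
by case=> [q|[p|a b] [q|c d]] //; rewrite [prim_eval _ _]/= dsize_bool.
Qed.

(** * Loops and folds *)

Lemma iter_run_while pc pf c f (bc bf : {poly nat}) M k x :
  (forall y, exists2 t, run pc y (c y) t & t + dsize (c y) <= bc.[dsize y]%R) ->
  (forall y, exists2 t, run pf y (f y) t & t + dsize (f y) <= bf.[dsize y]%R) ->
  (forall i, i < k -> truthy (c (iter i f x))) ->
  ~~ truthy (c (iter k f x)) ->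
  (forall i, i <= k -> dsize (iter i f x) <= M) ->
  exists2 t, run (While pc pf) x (iter k f x) t
    & t <= k.+1 * (M + bc.[M]%R + bf.[M]%R).
Proof.
move=> Hc Hf; elim: k x => [|k IH] x ct cf szM.
  have [t r le] := Hc x; exists (dsize x + t); first exact: run_while_stop r cf.
  have sx := szM 0 (leqnn 0); have := leq_horner bc sx; move: sx => /=; lia.
have [t r le] := Hc x; have [t' r' le'] := Hf x.
have sx : dsize x <= M := szM 0 (leq0n _).
have [||| t2 r2 le2] := IH (f x).
- by move=> i ik; rewrite -iterSr; exact: ct.
- by rewrite -iterSr.
- by move=> i ik; rewrite -iterSr; exact: szM.
exists (dsize x + t + t' + t2).
  by rewrite iterSr; exact: (run_while_step r (ct 0 isT) r' r2).
by have := leq_horner bc sx; have := leq_horner bf sx; lia.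
Qed.

(** Polynomial growth per round may compound to exponential growth, so the number of rounds and the
    size of every intermediate state are both bounded in terms of the original input. *)
Lemma ptime_while c f g (k : data -> nat) (K B : {poly nat}) :
  ptime c -> ptime f -> ptime g ->
  (forall x i, i < k x -> truthy (c (iter i f (g x)))) ->
  (forall x, ~~ truthy (c (iter (k x) f (g x)))) ->
  (forall x, k x <= K.[dsize x]%R) ->
  (forall x i, i <= k x -> dsize (iter i f (g x)) <= B.[dsize x]%R) ->
  ptime (fun x => iter (k x) f (g x)).
Proof.
move=> [pc [bc Hc]] [pf [bf Hf]] [pg [bg Hg]] ct cf kK szB.
apply: (@ptimeI _ (Seq pg (While pc pf)) (fun n => bg.[n]%R
    + (K.[n]%R + 1) * (B.[n]%R + bc.[B.[n]]%R + bf.[B.[n]]%R) + B.[n]%R)).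
  by poly_bounded.
move=> x; have [t r le] := Hg x.
have [t' r' le'] := iter_run_while Hc Hf (ct x) (cf x) (szB x).
exists (t + t'); first exact: run_seq r r'.
have := szB x (k x) (leqnn _).
have : (k x).+1 * (B.[dsize x]%R + bc.[B.[dsize x]]%R + bf.[B.[dsize x]]%R) <=
   (K.[dsize x]%R + 1) * (B.[dsize x]%R + bc.[B.[dsize x]]%R + bf.[B.[dsize x]]%R).
  by rewrite leq_mul2r addn1 ltnS kK orbT.
by move: (_ * _) (_ * _) le le' => u v; lia.
Qed.

Fixpoint ditems (l : data) : seq data :=
  if l is Node x l' then x :: ditems l' else [::].

Definition dstep (f : data -> data) (c a y : data) : data :=
  f (Node c (Node a y)).

Definition dfold (f : data -> data) (c a l : data) : data :=
  foldl (dstep f c) a (ditems l).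

(** The loop state consists of the fixed parameter, the accumulator and the unread part of the
    list. *)
Definition fold_body (f : data -> data) (s : data) : data :=
  Node (dfst s)
    (Node (dstep f (dfst s) (dfst (dsnd s)) (dfst (dsnd (dsnd s))))
          (dsnd (dsnd (dsnd s)))).

Lemma size_ditems l : size (ditems l) <= dsize l.
Proof. by elim: l => //= a _ b; lia. Qed.

Lemma iter_fold_body f c a l i : i <= size (ditems l) ->
  iter i (fold_body f) (Node c (Node a l)) =
  Node c (Node (foldl (dstep f c) a (take i (ditems l))) (iter i dsnd l)).
Proof.
elim: i a l => [|i IH] a l; first by rewrite take0.
by case: l => [q|x l] //=; rewrite -!/(iter i.+1 _ _) !iterSr => il; rewrite -IH.
Qed.

Lemma isnode_iter_snd l i : truthy (disnode (iter i dsnd l)) = (i < size (ditems l)).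
Proof.
elim: i l => [|i IH] [q|x l] //; rewrite iterSr ?IH //=.
Qed.

Lemma dsize_iter_snd l i : dsize (iter i dsnd l) <= dsize l.
Proof. by elim: i => //= i; apply: leq_trans; exact: dsize_snd. Qed.

Lemma ptime_fold f c a l B : ptime f -> ptime c -> ptime a -> ptime l ->
  poly_bounded B ->
  (forall x i, dsize (foldl (dstep f (c x)) (a x) (take i (ditems (l x))))
                 <= B (dsize x)) ->
  ptime (fun x => dfold f (c x) (a x) (l x)).
Proof.
move=> pf pc pa pl [b Bb] szB.
have [bc szc] := ptime_dsize pc; have [bl szl] := ptime_dsize pl.
pose g x := Node (c x) (Node (a x) (l x)).
pose k x := size (ditems (l x)).
apply: (@eq_ptime (fun x => dfst (dsnd (iter (k x) (fold_body f) (g x))))).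
  by move=> x; rewrite iter_fold_body //= take_size.
apply/ptime_fst/ptime_snd.
have [b' b'P] : poly_bounded (fun n => bc.[n]%R + (b.[n]%R + bl.[n]%R) + 2).
  by poly_bounded.
have pt : ptime (fold_body f).
  have p1 := ptime_snd ptime_id; have p2 := ptime_snd p1.
  rewrite /fold_body /dstep.
  apply: ptime_pair; first exact: ptime_fst ptime_id.
  apply: ptime_pair; last exact: ptime_snd.
  apply: ptime_comp pf _.
  apply: ptime_pair; first exact: ptime_fst ptime_id.
  by apply: ptime_pair; apply: ptime_fst.
apply: (@ptime_while (fun s => disnode (dsnd (dsnd s))) _ _ k bl b') => //.
- by apply: ptime_isnode; do 2![apply: ptime_snd]; exact: ptime_id.
- by apply: ptime_pair => //; apply: ptime_pair.
- by move=> x i ik; rewrite iter_fold_body ?isnode_iter_snd // ltnW.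
- by move=> x; rewrite iter_fold_body //= isnode_iter_snd ltnn.
- by move=> x; apply: leq_trans (szl x); exact: size_ditems.
move=> x i ik; rewrite iter_fold_body //=; apply: leq_trans (b'P _).
have := szc x; have := leq_trans (dsize_iter_snd (l x) i) (szl x).
have := leq_trans (szB x i) (Bb _); lia.
Qed.

(** An increment that does not depend on the accumulator cannot compound: there are at most
    [dsize l] steps, each adding at most the same amount. *)
Lemma dsize_foldl_take f c a l G :
  {homo G : m n / m <= n} ->
  (forall c a y, dsize (dstep f c a y) <= dsize a + G (dsize (Node c y))) ->
  forall i, dsize (foldl (dstep f c) a (take i (ditems l)))
    <= dsize a + dsize l * G (dsize (Node c l)).
Proof.
move=> homG stepG; elim: l a => [q|y _ l IH] a i; first exact: leq_addr.
case: i => [|i]; first exact: leq_addr.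
rewrite [take _ _]/= [foldl _ _ _]/=; apply: leq_trans (IH _ _) _.
have G1 : G (dsize (Node c l)) <= G (dsize (Node c (Node y l))) by apply: homG => /=; lia.
have G2 : G (dsize (Node c y)) <= G (dsize (Node c (Node y l))) by apply: homG => /=; lia.
have := stepG c a y; rewrite [dsize (Node y l)]/= mulSn mulnDl.
move: G1 G2; set g := G (dsize (Node c (Node y l))) => G1 G2.
have : dsize l * G (dsize (Node c l)) <= dsize l * g by rewrite leq_mul2l G1 orbT.
lia.
Qed.

Lemma ptime_fold_additive f c a l (G : {poly nat}) :
  ptime f -> ptime c -> ptime a -> ptime l ->
  (forall c a y, dsize (dstep f c a y) <= dsize a + G.[dsize (Node c y)]%R) ->
  ptime (fun x => dfold f (c x) (a x) (l x)).
Proof.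
move=> pf pc pa pl stepG.
have [bc szc] := ptime_dsize pc; have [bl szl] := ptime_dsize pl.
have [ba sza] := ptime_dsize pa.
apply: (@ptime_fold _ _ _ _ (fun n => ba.[n]%R
   + bl.[n]%R * G.[bc.[n]%R + bl.[n]%R + 1]%R)) => //; first by poly_bounded.
move=> x i; have := szc x; have := szl x; have := sza x => ta tl tc.
apply: leq_trans (dsize_foldl_take _ _ _ (@leq_horner G) stepG _) _.
rewrite leq_add // leq_mul //.
by apply: leq_horner => /=; lia.
Qed.

(** * List programs *)

Ltac ptime_using call := repeat first
  [ exact: ptime_id | assumption | call | apply: ptime_leaf | apply: ptime_pair
  | apply: ptime_fst | apply: ptime_snd | apply: ptime_isnode
  | apply: ptime_add | apply: ptime_le | apply: ptime_if ].

Ltac ptime := ptime_using fail.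

Lemma dlistK s : ditems (dlist s) = s.
Proof. by elim: s => //= x s ->. Qed.

Lemma dfold_dlist f c a s : dfold f c a (dlist s) = foldl (dstep f c) a s.
Proof. by rewrite /dfold dlistK. Qed.

Definition deq (x y : data) : data :=
  if truthy (dle x y) then dle y x else Leaf 0.

Lemma truthy_bool b : truthy (dbool b) = b.
Proof. by case: b. Qed.

Lemma dle_leaf p q : dle (Leaf p) (Leaf q) = dbool (p <= q)%R.
Proof. by []. Qed.

Lemma truthy_deq m n : truthy (deq (dnat m) (dnat n)) = (m == n).
Proof.
rewrite /deq /dnat !dle_leaf !ler_nat truthy_bool eqn_leq.
by case: ifP => _; rewrite ?truthy_bool.
Qed.

Definition nth_step (z : data) : data :=
  Node (dadd (dfst (dfst (dsnd z))) (Leaf 1))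
    (if truthy (deq (dfst (dfst (dsnd z))) (dfst z))
     then dsnd (dsnd z) else dsnd (dfst (dsnd z))).

Definition dnth (l i : data) : data :=
  dsnd (dfold nth_step i (Node (dnat 0) (Leaf 0)) l).

Lemma nth_stepE c k r y : dstep nth_step c (Node (dnat k) r) y =
  Node (dnat k.+1) (if truthy (deq (dnat k) c) then y else r).
Proof. by rewrite /dstep /nth_step [dnat k.+1]/dnat -natr1. Qed.

Lemma dsize_nat n : dsize (dnat n) <= n + 2.
Proof.
rewrite /dnat [dsize _]/= pmulrn numq_int denq_int addn2 -addn1.
by rewrite leq_add ?bitlen_leqS.
Qed.

Lemma dsize_take_items l i : dsize (dlist (take i (ditems l))) <= dsize l.
Proof.
elim: l i => [q|x _ l IH] [|i]; try exact: dsize_ge2.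
by rewrite /= ltnS leq_add2l.
Qed.

Lemma ptime_nth f g : ptime f -> ptime g -> ptime (fun x => dnth (f x) (g x)).
Proof.
move=> pf pg; have [b szf] := ptime_dsize pf; apply: ptime_snd.
(* The general bound for [dadd] doubles sizes and is no help for an iterated counter. The counter is
   bounded through its value instead, which is at most the number of items read. *)
apply: (@ptime_fold _ _ _ _ (fun n => (b.[n]%R + 2) + (2 + b.[n]%R) + 1)); ptime.
- by poly_bounded.
move=> x i; set s := take _ _; set c := g x.
have H k r : exists2 r', foldl (dstep nth_step c) (Node (dnat k) r) s =
    Node (dnat (k + size s)) r' & dsize r' <= dsize r + dsize (dlist s).
  elim: s k r => [|y s IH] k r; first by exists r; rewrite ?addn0 ?leq_addr.
  rewrite [foldl _ _ _]/= nth_stepE; set r1 := (if _ then _ else _).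
  have [r' -> le] := IH k.+1 r1; exists r'; first by rewrite addnS.
  have : dsize r1 <= dsize r + dsize y by rewrite /r1; case: ifP; lia.
  by move=> /=; lia.
have [r' -> le] := H 0 (Leaf 0).
have le1 := leq_trans (dsize_take_items (f x) i) (szf x).
have le2 : size s <= b.[dsize x]%R.
  by apply: leq_trans le1; have := size_ditems (dlist s); rewrite dlistK.
have := dsize_nat (0 + size s).
rewrite -[dsize (Node _ _)]/((dsize (dnat (0 + size s)) + dsize r').+1).
by move: le; rewrite -[dsize (Leaf 0)]/2 -/s in le1 *; lia.
Qed.

Lemma dnthE (s : seq data) i : i < size s ->
  dnth (dlist s) (dnat i) = nth (Leaf 0) s i.
Proof.
move=> lt_is; rewrite /dnth dfold_dlist.
(* Once the counter has passed [i], the stored entry is never overwritten. *)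
have done k r t : i < k -> dsnd (foldl (dstep nth_step (dnat i)) (Node (dnat k) r) t) = r.
  elim: t k r => [|y t IH] k r ik //=; rewrite nth_stepE truthy_deq gtn_eqF //.
  by apply: IH; exact: ltnW.
suff H k r t : k <= i -> i - k < size t ->
    dsnd (foldl (dstep nth_step (dnat i)) (Node (dnat k) r) t) =
    nth (Leaf 0) t (i - k) by rewrite H ?subn0.
elim: t k r => [|y t IH] k r //= ki; rewrite nth_stepE truthy_deq.
case: eqP => [->|/eqP ki']; first by rewrite done ?subnn.
have lt_ki : k < i by rewrite ltn_neqAle ki'.
by rewrite -(subnSK lt_ki) /= ltnS; exact: IH.
Qed.

Definition drev (l : data) : data :=
  dfold (fun z => Node (dsnd (dsnd z)) (dfst (dsnd z))) (Leaf 0) (Leaf 0) l.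

Lemma ptime_rev f : ptime f -> ptime (fun x => drev (f x)).
Proof.
move=> pf; apply: (@ptime_fold_additive _ _ _ _ ('X)%R); ptime.
by move=> c a y; rewrite /dstep /= hornerX; lia.
Qed.

Lemma drevE s : drev (dlist s) = dlist (rev s).
Proof.
rewrite /drev dfold_dlist /rev -[foldl _ (Leaf 0)]/(foldl _ (dlist [::])).
by elim: s [::] => //= x s IH t; rewrite -IH.
Qed.

Definition dmap (h : data -> data) (c l : data) : data :=
  drev (dfold (fun z => Node (h (Node (dfst z) (dsnd (dsnd z)))) (dfst (dsnd z)))
          c (Leaf 0) l).

Lemma ptime_map h f g : ptime h -> ptime f -> ptime g ->
  ptime (fun x => dmap h (f x) (g x)).
Proof.
move=> ph pf pg; have [b szh] := ptime_dsize ph; apply: ptime_rev.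
apply: (@ptime_fold_additive _ _ _ _ (b + 1)%R); ptime.
  by apply: ptime_comp ph _; ptime.
move=> c a y; rewrite /dstep /= hornerD hornerC natrDE.
by have := szh (Node c y); move=> /=; lia.
Qed.

Lemma dmapE h c s : dmap h c (dlist s) = dlist [seq h (Node c y) | y <- s].
Proof.
rewrite /dmap dfold_dlist -[Leaf 0]/(dlist [::]).
set F := foldl _ _ _; suff -> : F = dlist (rev [seq h (Node c y) | y <- s]).
  by rewrite drevE revK.
by rewrite /F /rev {F}; elim: s [::] => //= x s IH t; rewrite -IH.
Qed.

(** The accumulator holds the unread part of the second list and the pairs formed so far. The pairs
    come out reversed, which is harmless in a list that is only searched for a minimum. *)
Definition zip_step (z : data) : data :=
  Node (dsnd (dfst (dfst (dsnd z))))
    (Node (Node (dsnd (dsnd z)) (dfst (dfst (dfst (dsnd z)))))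
          (dsnd (dfst (dsnd z)))).

Definition dzip_rev (l l' : data) : data :=
  dsnd (dfold zip_step (Leaf 0) (Node l' (Leaf 0)) l).

Lemma ptime_zip_rev f g : ptime f -> ptime g ->
  ptime (fun x => dzip_rev (f x) (g x)).
Proof.
move=> pf pg; apply: ptime_snd.
apply: (@ptime_fold_additive _ _ _ _ ('X + 10%:P)%R); ptime.
move=> c a y; rewrite /dstep hornerD hornerX hornerC natrDE /=.
by have := dsize_fst_snd (dfst a); have := dsize_fst_snd a; lia.
Qed.

Lemma dzip_revE (J : Type) (u v : J -> data) js :
  dzip_rev (dlist (map u js)) (dlist (map v js)) =
  dlist [seq Node (u j) (v j) | j <- rev js].
Proof.
rewrite /dzip_rev dfold_dlist /rev -[Node _ (Leaf 0)]/(Node _ (dlist [seq Node (u j) (v j) | j <- [::]])).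
by elim: js [::] => //= j js IH t; rewrite -IH.
Qed.

Definition dmem (x l : data) : data :=
  dfold (fun z => if truthy (deq (dfst z) (dsnd (dsnd z))) then Leaf 1
                  else dfst (dsnd z)) x (Leaf 0) l.

Lemma ptime_mem f g : ptime f -> ptime g -> ptime (fun x => dmem (f x) (g x)).
Proof.
move=> pf pg; apply: (@ptime_fold_additive _ _ _ _ ('X)%R); ptime.
move=> c a y; rewrite /dstep hornerX /=; case: ifP => _ /=; last lia.
by have := dsize_ge2 c; rewrite /= -/(dsize (Leaf 1)) (_ : dsize (Leaf 1) = 2) //; lia.
Qed.

Lemma dmemE k s : truthy (dmem (dnat k) (dlist (map dnat s))) = (k \in s).
Proof.
rewrite /dmem dfold_dlist.
suff H a : truthy (foldl (dstep (fun z => if truthy (deq (dfst z) (dsnd (dsnd z)))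
     then Leaf 1 else dfst (dsnd z)) (dnat k)) a (map dnat s)) =
     truthy a || (k \in s) by rewrite H.
elim: s a => [|x s IH] a; first by rewrite orbF.
rewrite /= IH /dstep /= truthy_deq in_cons.
by case: ifP => //= _; rewrite orbT.
Qed.

(* An entry of T pairs the costs c(., j) of a client j with the facility      *)
(* phi(j); its value at i is c(phi(j), j) + c(i, j).                          *)
Definition near_value (i y : data) : data :=
  dadd (dnth (dfst y) (dsnd y)) (dnth (dfst y) i).

(** The accumulator is a leaf until an entry has been read, and then a pair of the least value so
    far and its facility; the node test tells the two apart. *)
Definition near_step (z : data) : data :=
  let a := dfst (dsnd z) in let y := dsnd (dsnd z) in
  if truthy (if truthy (disnode a) then dle (dfst a) (near_value (dfst z) y)
             else Leaf 0)
  then a else Node (near_value (dfst z) y) (dsnd y).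

Definition dnearest (T i : data) : data :=
  dsnd (dfold near_step i (Leaf 0) T).

Lemma ptime_nearest f g : ptime f -> ptime g ->
  ptime (fun x => dnearest (f x) (g x)).
Proof.
have pv f1 g1 : ptime f1 -> ptime g1 -> ptime (fun x => near_value (f1 x) (g1 x)).
  by move=> pf1 pg1; apply: ptime_add; apply: ptime_nth; ptime.
move=> pf pg; apply: ptime_snd.
have [b szv] := ptime_dsize (pv _ _ (ptime_fst ptime_id) (ptime_snd ptime_id)).
apply: (@ptime_fold_additive _ _ _ _ (b + 'X + 1)%R); ptime_using ltac:(apply: pv).
move=> c a y; rewrite /dstep /near_step /= -/(dsize (Node c y)).
rewrite !hornerD hornerX hornerC !natrDE.
case: ifP => _; first by rewrite -!addnA leq_addr.
have := szv (Node c y); have := dsize_snd y => /=; move: (near_value _ _) => v; lia.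
Qed.

Lemma dnearestE (J : eqType) n (w : J -> 'I_n -> rat) (phi : J -> 'I_n) js i :
  js != [::] ->
  exists2 j, j \in js /\ {in js, forall j',
     w j (phi j) + w j i <= w j' (phi j') + w j' i}%R &
  dnearest (dlist [seq Node (dlist [seq Leaf (w j k) | k <- enum 'I_n])
                           (dnat (phi j)) | j <- js]) (dnat i) = dnat (phi j).
Proof.
pose v j := (w j (phi j) + w j i)%R.
pose u j := Node (dlist [seq Leaf (w j k) | k <- enum 'I_n]) (dnat (phi j)).
rewrite -[[seq _ | j <- js]]/(map u js).
have nthw j k : dnth (dlist [seq Leaf (w j k) | k <- enum 'I_n]) (dnat (nat_of_ord k))
    = Leaf (w j k).
  have lt_k : k < size (enum 'I_n) by rewrite size_enum_ord.
  rewrite dnthE; last by rewrite size_map.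
  by rewrite (nth_map k) // nth_ord_enum.
have uv j : near_value (dnat i) (u j) = Leaf (v j).
  by rewrite /near_value /= !nthw.
case: js => // j0 js _; rewrite /dnearest dfold_dlist [foldl _ _ _]/=.
have -> : dstep near_step (dnat i) (Leaf 0) (u j0) = Node (Leaf (v j0)) (dnat (phi j0)).
  by rewrite /dstep /near_step /= -/(u j0) uv.
(* The accumulator now depends only on the current best client, so the induction discards the loser
   among [j0] and [j1]. *)
elim: js j0 => [|j1 js IH] j0.
  by exists j0 => //; split=> [|j']; rewrite inE // => /eqP ->.
rewrite [foldl _ _ _]/=.
have -> : dstep near_step (dnat i) (Node (Leaf (v j0)) (dnat (phi j0))) (u j1) =
   if (v j0 <= v j1)%R then Node (Leaf (v j0)) (dnat (phi j0))
   else Node (Leaf (v j1)) (dnat (phi j1)).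
  rewrite /dstep /near_step [dsnd _]/= [dfst _]/= uv [dsnd _]/=.
  by rewrite [dfst (Node (Leaf _) _)]/= dle_leaf (_ : truthy (disnode _)) // truthy_bool.
case: ifP => [le01|/negbT]; last rewrite -ltNge => /ltW le10.
  have [j [jin jmin] ->] := IH j0; exists j => //; split.
    by move: jin; rewrite !inE => /orP[->|->] //; rewrite !orbT.
  move=> j'; rewrite !inE => /or3P[/eqP->|/eqP->|j'in].
  - by apply: jmin; rewrite inE eqxx.
  - by apply: le_trans le01; apply: jmin; rewrite inE eqxx.
  - by apply: jmin; rewrite inE j'in orbT.
have [j [jin jmin] ->] := IH j1; exists j => //; split.
  by rewrite inE jin orbT.
move=> j'; rewrite inE => /orP[/eqP->|]; last exact: jmin.
by apply: le_trans le10; apply: jmin; rewrite inE eqxx.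
Qed.

(** * The path of images without repetitions *)

Definition dedup_step (z : data) : data :=
  let k := dnearest (dfst z) (dsnd (dsnd z)) in
  if truthy (dmem k (dfst (dsnd z))) then dfst (dsnd z)
  else Node k (dfst (dsnd z)).

Definition dnearest_path (T p : data) : data :=
  drev (dfold dedup_step T (Leaf 0) p).

Lemma ptime_nearest_path f g : ptime f -> ptime g ->
  ptime (fun x => dnearest_path (f x) (g x)).
Proof.
move=> pf pg; apply: ptime_rev.
have [b szn] := ptime_dsize (ptime_nearest (ptime_fst ptime_id) (ptime_snd ptime_id)).
apply: (@ptime_fold_additive _ _ _ _ (b + 1)%R);
  ptime_using ltac:(first [apply: ptime_mem | apply: ptime_nearest]).
move=> c a y; rewrite /dstep /dedup_step /= -/(dsize (Node c y)).
rewrite !hornerD hornerC !natrDE.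
case: ifP => _; first by rewrite leq_addr.
have := szn (Node c y) => /=; lia.
Qed.

(* undup would keep the last occurrences, for which positions may increase.   *)
Definition first_images (T : eqType) (sigma : T -> T) (s : seq T) : seq T :=
  foldl (fun u i => if sigma i \in u then u else rcons u (sigma i)) [::] s.

Lemma dnearest_pathE n (sigma : 'I_n -> 'I_n) (T : data) s :
  (forall i : 'I_n, dnearest T (dnat i) = dnat (sigma i)) ->
  dnearest_path T (dlist [seq dnat (nat_of_ord i) | i <- s]) =
  dlist [seq dnat (nat_of_ord i) | i <- first_images sigma s].
Proof.
move=> sigmaE; rewrite /dnearest_path dfold_dlist /first_images.
rewrite -[Leaf 0]/(dlist (rev [seq dnat (nat_of_ord i) | i <- Nil 'I_n])).
elim: s (Nil 'I_n) => [|i s IH] u /=; first by rewrite drevE revK.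
rewrite -{}IH; congr (drev (foldl _ _ _)).
rewrite /dstep /dedup_step /= sigmaE -map_rev [X in dlist X](map_comp dnat) dmemE.
rewrite mem_map; last exact: val_inj.
by rewrite mem_rev; case: ifP => _; rewrite -!map_rev ?rev_rcons -map_comp.
Qed.

(** * Combining the two solutions *)

Local Open Scope ring_scope.

Lemma first_images_rcons (T : eqType) (sigma : T -> T) s i :
  first_images sigma (rcons s i) =
  if sigma i \in first_images sigma s then first_images sigma s
  else rcons (first_images sigma s) (sigma i).
Proof. by rewrite /first_images foldl_rcons. Qed.

Lemma mem_first_images (T : eqType) (sigma : T -> T) s :
  first_images sigma s =i [seq sigma i | i <- s].
Proof.
elim/last_ind: s => // s i IH x; rewrite first_images_rcons map_rcons.
rewrite mem_rcons in_cons -IH; case: ifP => [si|_]; last by rewrite mem_rcons.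
by case: eqP => // ->.
Qed.

Lemma first_images_uniq (T : eqType) (sigma : T -> T) s :
  uniq (first_images sigma s).
Proof.
elim/last_ind: s => // s i IH; rewrite first_images_rcons.
by case: ifP => // /negbT si; rewrite rcons_uniq si.
Qed.

Lemma size_first_images (T : eqType) (sigma : T -> T) s :
  (size (first_images sigma s) <= size s)%N.
Proof.
elim/last_ind: s => // s i IH; rewrite first_images_rcons size_rcons.
by case: ifP => _; [exact: leqW | rewrite size_rcons ltnS].
Qed.

(** Every entry before [i] contributes at most one new image, so no more images than entries can
    precede [sigma i]. *)
Lemma position_first_images (T : eqType) (sigma : T -> T) s i : i \in s ->
  (position (first_images sigma s) (sigma i) <= position s i)%N.
Proof.
rewrite /position ltnS.
elim/last_ind: s => // s k IH; rewrite first_images_rcons -cats1.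
rewrite mem_cat mem_seq1 index_cat; case: (boolP (i \in s)) => [ins _|nins] /=.
  have sin : sigma i \in first_images sigma s by rewrite mem_first_images map_f.
  by case: ifP => _; rewrite ?index_cat -?cats1 ?index_cat ?sin; exact: IH.
(* Here the first occurrence of [i] is the last entry: its image either occurs already or is
   appended after at most [size s] images. *)
move=> /eqP ->; rewrite eqxx addn0.
case: ifP => [sin|sin]; last first.
  by rewrite -cats1 index_cat sin /= eqxx addn0 size_first_images.
by apply: leq_trans (size_first_images sigma s); rewrite ltnW // index_mem.
Qed.

(** * Existence of optima and comparison of the problems *)

Definition zero_instance (I : instance) : instance :=
  {| fcost := fun=> 0; ccost := @ccost I;
     fcost_ge0 := fun=> lexx 0; ccost_ge0 := @ccost_ge0 I |}.

Lemma metric_zero_instance I :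
  metric_instance I -> metric_instance (zero_instance I).
Proof. by []. Qed.

Lemma ufl_cost_ge0 I (S : solution UFL I) : 0 <= cost S.
Proof.
apply: addr_ge0; apply: sumr_ge0 => *; [exact: fcost_ge0 | exact: ccost_ge0].
Qed.

Lemma mlufl_cost_ge0 I (S : solution uniform_MLUFL I) : 0 <= cost S.
Proof.
apply: addr_ge0; apply: sumr_ge0 => *; first exact: fcost_ge0.
by rewrite addr_ge0 // ccost_ge0.
Qed.

Lemma exists_minimizer (T : finType) (P : pred T) (F : T -> rat) x0 : P x0 ->
  exists2 x, P x & forall y, P y -> F x <= F y.
Proof. by move=> Px0; case: (arg_minP F Px0) => x Px xmin; exists x. Qed.

(** Up to extensional equality of assignments, which preserves cost and feasibility, there are
    finitely many solutions. *)
Lemma ufl_optimal_exists I (S0 : solution UFL I) : feasible S0 ->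
  exists S : solution UFL I, optimal S.
Proof.
pose dec (u : {set 'I_(nfac I)} * {ffun 'I_(ncli I) -> 'I_(nfac I)}) :
  solution UFL I := UflSolution u.1 u.2.
pose ok u := [forall j, ufl_assign (dec u) j \in ufl_open (dec u)].
have encE (S : solution UFL I) : feasible S ->
    exists2 u, ok u & cost (dec u) = cost S.
  move=> fS; exists (ufl_open S, finfun (ufl_assign S)).
    by apply/forallP => j; rewrite /= ffunE; exact: fS.
  by rewrite /cost /=; congr (_ + _); apply: eq_bigr => j _; rewrite /= ffunE.
move=> /encE [u0 /(exists_minimizer (fun u => cost (dec u)))].
move=> [u /forallP fu umin] _.
exists (dec u); split=> // S /encE [v okv <-]; exact: umin.
Qed.

Lemma uniq_ord_size n (s : seq 'I_n) : uniq s -> (size s <= n)%N.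
Proof. by move=> /card_uniqP <-; rewrite (leq_trans (max_card _)) ?card_ord. Qed.

(** Paths without repetition have length at most the number of facilities, so bounded sequences form
    a finite search space. *)
Lemma mlufl_optimal_exists I (S0 : solution uniform_MLUFL I) : feasible S0 ->
  exists S : solution uniform_MLUFL I, optimal S.
Proof.
pose dec (u : {bseq nfac I of 'I_(nfac I)} * {ffun 'I_(ncli I) -> 'I_(nfac I)}) :
  solution uniform_MLUFL I := MluflSolution u.1 u.2.
pose ok u := uniq (mlufl_path (dec u)) &&
  [forall j, mlufl_assign (dec u) j \in mlufl_path (dec u)].
have encE (S : solution uniform_MLUFL I) : feasible S ->
    exists2 u, ok u & cost (dec u) = cost S.
  case: S => s phi [/= us fS].
  have ss := uniq_ord_size us.
  exists (Bseq ss, finfun phi).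
    by rewrite /ok /= us; apply/forallP => j; rewrite /= ffunE.
  by rewrite /cost /=; congr (_ + _); apply: eq_bigr => j _; rewrite /= ffunE.
move=> /encE [u0 /(exists_minimizer (fun u => cost (dec u)))].
move=> [u /andP[uu /forallP fu] umin] _.
exists (dec u); split=> // S /encE [v okv <-]; exact: umin.
Qed.

Lemma ufl_le_mlufl I (S : solution uniform_MLUFL I) : feasible S ->
  exists2 S' : solution UFL I, feasible S' & cost S' <= cost S.
Proof.
case: S => s phi [/= us fS].
exists (UflSolution [set i in s] phi) => /=; first by move=> j; rewrite inE.
apply: lerD; last by apply: ler_sum => j _; rewrite lerDl.
by rewrite big_uniq //= le_eqVlt; apply/orP/or_introl/eqP/eq_bigl => i; rewrite inE.
Qed.

Lemma mlufl_zero_le I (S : solution uniform_MLUFL I) : feasible S ->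
  exists2 S' : solution uniform_MLUFL (zero_instance I),
    feasible S' & cost S' <= cost S.
Proof.
case: S => s phi fS; exists (MluflSolution (I := zero_instance I) s phi) => //=.
by rewrite lerD2r; apply: ler_sum => i _; exact: fcost_ge0.
Qed.

(** * The combined solution and its cost *)

Definition combined I (S2 : solution uniform_MLUFL (zero_instance I))
    (sigma : 'I_(nfac I) -> 'I_(nfac I)) : solution uniform_MLUFL I :=
  MluflSolution (I := I) (first_images sigma (mlufl_path S2))
    (sigma \o mlufl_assign S2).

Lemma combined_feasible I (S2 : solution uniform_MLUFL (zero_instance I)) sigma :
  feasible S2 -> feasible (combined S2 sigma).
Proof.
move=> [_ feas2]; split; first exact: first_images_uniq.
by move=> j; rewrite mem_first_images /= map_f.
Qed.

(* The metric between facilities is not part of the input: i is sent to the   *)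
(* facility serving the client k that minimizes c(phi k, k) + c(i, k), an     *)
(* upper bound on the distance from i to phi k.                               *)
Definition nearby I (phi : 'I_(ncli I) -> 'I_(nfac I))
    (sigma : 'I_(nfac I) -> 'I_(nfac I)) : Prop :=
  forall i, exists2 k, sigma i = phi k &
    forall j, ccost (phi k) k + ccost i k <= ccost (phi j) j + ccost i j.

Lemma ccost_nearby I phi sigma (i : 'I_(nfac I)) (j : 'I_(ncli I)) :
  metric_instance I -> nearby phi sigma ->
  ccost (sigma i) j <= ccost (phi j) j + 2 * ccost i j.
Proof.
move=> [d [_ _ dC tri] dE] near; have [k -> /(_ j)] := near i.
have := tri (inl (phi k)) (inr k) (inr j); have := tri (inr k) (inl i) (inr j).
rewrite (dC (inr k) (inl i)) !dE; lra.
Qed.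

(** The new path is free of repetitions and visits only facilities that [S1] assigns to some client,
    hence opens, so [S1] covers the facility costs. The rest is compared client by client. *)
Lemma combined_cost I (S1 : solution UFL I)
    (S2 : solution uniform_MLUFL (zero_instance I)) sigma :
  metric_instance I -> feasible S1 -> feasible S2 ->
  nearby (ufl_assign S1) sigma ->
  cost (combined S2 sigma) <= cost S1 + 2 * cost S2.
Proof.
move=> metI feas1 feas2 near.
rewrite /= [X in 2 * (X + _)]big1 // add0r -addrA; apply: lerD.
  rewrite big_uniq ?first_images_uniq //=.
  rewrite [leLHS]big_mkcond [leRHS]big_mkcond; apply: ler_sum => i _.
  case: ifP => [|_]; last by case: ifP => // _; exact: fcost_ge0.
  rewrite mem_first_images => /mapP[k _ ->]; have [j -> _] := near k.
  by rewrite feas1.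
rewrite mulr_sumr -big_split /=; apply: ler_sum => j _.
have := ccost_nearby (mlufl_assign S2 j) j metI near.
have [_ /(_ j)/(position_first_images sigma)] := feas2.
set q := position _ _; set p := position _ _.
(* The bound allows each position twice but needs it once; the surplus [p] is nonnegative. *)
rewrite -(ler_nat rat) => le_qp; have := ler0n rat p; lra.
Qed.

(** * The combining program *)

Definition dzero (E : data) : data :=
  Node (dmap (fun=> Leaf 0) (Leaf 0) (dfst E)) (dsnd E).

Lemma ptime_zero : ptime dzero.
Proof. by rewrite /dzero; ptime_using ltac:(apply: ptime_map). Qed.

Lemma dzeroE I : dzero (enc_instance I) = enc_instance (zero_instance I).
Proof. by rewrite /dzero /= dmapE -map_comp. Qed.

(* x encodes an instance, a UFL solution and an MLUFL solution, in this order. *)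
Definition dcombine (x : data) : data :=
  let T := dzip_rev (dsnd (dfst x)) (dsnd (dfst (dsnd x))) in
  Node (dnearest_path T (dfst (dsnd (dsnd x))))
       (dmap (fun z => dnearest (dfst z) (dsnd z)) T (dsnd (dsnd (dsnd x)))).

Lemma ptime_combine : ptime dcombine.
Proof.
rewrite /dcombine; ptime_using ltac:(first [apply: ptime_nearest_path
  | apply: ptime_map | apply: ptime_nearest | apply: ptime_zip_rev]).
Qed.

Lemma dcombineE I (S1 : solution UFL I)
    (S2 : solution uniform_MLUFL (zero_instance I)) : (0 < ncli I)%N ->
  exists2 sigma, nearby (ufl_assign S1) sigma &
    dcombine (Node (enc_instance I) (Node (enc_solution S1) (enc_solution S2))) =
    enc_solution (combined S2 sigma).
Proof.
move=> m0; rewrite /dcombine /= /dassign dzip_revE.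
set T := dlist _.
have Tnear i : exists j, (forall j', ccost (ufl_assign S1 j) j + ccost i j
        <= ccost (ufl_assign S1 j') j' + ccost i j') /\
    dnearest T (dnat (nat_of_ord i)) = dnat (ufl_assign S1 j).
  have ne : rev (enum 'I_(ncli I)) != [::].
    by rewrite -size_eq0 size_rev size_enum_ord -lt0n.
  have [j [_ jmin] eT] := dnearestE (fun j i => ccost i j) (ufl_assign S1) i ne.
  by exists j; split=> // j'; apply: jmin; rewrite mem_rev mem_enum.
(* The map [sigma] is read off from the answers of the program, so ties among minimizing clients
   need no convention. *)
have [near nearP] := fin_all_exists Tnear.
pose sigma i := ufl_assign S1 (near i).
have sigmaE i : dnearest T (dnat (nat_of_ord i)) = dnat (sigma i).
  by have [_] := nearP i.
exists sigma; first by move=> i; exists (near i) => //; have [] := nearP i.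
rewrite (dnearest_pathE _ sigmaE) dmapE -map_comp; congr (Node _ (dlist _)).
by apply: eq_map => j /=; rewrite sigmaE.
Qed.

(** * Sizes of encoded solutions *)

Lemma size_dlist s : (size s <= dsize (dlist s))%N.
Proof. by have := size_ditems (dlist s); rewrite dlistK. Qed.

Lemma nfac_leq_dsize I : (nfac I <= dsize (enc_instance I))%N.
Proof.
have := size_dlist [seq Leaf (fcost i) | i <- enum 'I_(nfac I)].
by rewrite size_map size_enum_ord /=; lia.
Qed.

Lemma ncli_leq_dsize I : (ncli I <= dsize (enc_instance I))%N.
Proof.
have := size_dlist [seq dlist [seq Leaf (ccost i j) | i <- enum 'I_(nfac I)]
                 | j <- enum 'I_(ncli I)].
by rewrite size_map size_enum_ord /=; lia.
Qed.

(** [approx_algorithm] bounds running times but states no bound on output sizes, so these are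
    derived from the encoding: at most [N] numerals below [N]. *)
Lemma dsize_ord_list n (s : seq 'I_n) N : (n <= N)%N -> (size s <= N)%N ->
  (dsize (dlist [seq dnat i | i : 'I_n <- s]) <= N * (N + 3) + 2)%N.
Proof.
move=> nN sN; apply: (@leq_trans (size s * (N + 3) + 2)); last first.
  by rewrite leq_add2r leq_mul2r sN orbT.
elim: s {sN} => // i s IH; rewrite [size _]/= mulSn.
rewrite -[dsize _]/((dsize (dnat i) + dsize (dlist [seq dnat i | i : 'I_n <- s])).+1).
move: IH (dsize_nat i) (ltn_ord i).
by move: (dsize _) (dsize _) (_ * _)%N => a b c; lia.
Qed.

Lemma dsize_assign n m (phi : 'I_m -> 'I_n) N : (n <= N)%N -> (m <= N)%N ->
  (dsize (dassign phi) <= N * (N + 3) + 2)%N.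
Proof.
move=> nN mN; rewrite /dassign (map_comp (fun i : 'I_n => dnat i) phi).
by apply: dsize_ord_list; rewrite // size_map size_enum_ord.
Qed.

Lemma dsize_ufl_solution I (S : solution UFL I) N :
  (nfac I <= N)%N -> (ncli I <= N)%N ->
  (dsize (enc_solution S) <= 2 * (N * (N + 3)) + 5)%N.
Proof.
move=> nN mN; have szF : (size (enum (ufl_open S)) <= N)%N.
  by rewrite -cardE (leq_trans (max_card _)) ?card_ord.
have := dsize_assign (ufl_assign S) nN mN; have := dsize_ord_list nN szF.
by move=> /=; lia.
Qed.

Lemma dsize_mlufl_solution I (S : solution uniform_MLUFL I) N : feasible S ->
  (nfac I <= N)%N -> (ncli I <= N)%N ->
  (dsize (enc_solution S) <= 2 * (N * (N + 3)) + 5)%N.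
Proof.
move=> [us _] nN mN; have szs := leq_trans (uniq_ord_size us) nN.
have := dsize_assign (mlufl_assign S) nN mN; have := dsize_ord_list nN szs.
by move=> /=; lia.
Qed.

(* A ratio has to be nonnegative for its product with an optimum to be        *)
(* monotone in the optimum; this follows from an instance of positive cost.   *)
Definition unit_instance : instance :=
  {| nfac := 1; ncli := 1; fcost := fun=> 0; ccost := fun _ _ => 1;
     fcost_ge0 := fun=> lexx 0; ccost_ge0 := fun _ _ => ler01 |}.

Lemma metric_unit_instance : metric_instance unit_instance.
Proof.
exists (fun x y => match x, y with
  | inl _, inr _ | inr _, inl _ => 1 | _, _ => 0 end) => //.
by split; [move=> [] ? [] ?|move=> [] ?|move=> [] ? [] ?|
  move=> [] ? [] ? [] ?].
Qed.

Lemma approx_ratio_ge0 (R : realFieldType) P (C : instance -> Prop) (alpha : R) A I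
    (S0 : solution P I) :
  (forall S : solution P I, 0 <= cost S) -> C I -> optimal S0 -> 0 < cost S0 ->
  approx_algorithm P C alpha A -> 0 <= alpha.
Proof.
move=> cost0 CI opt0 pos0 [b H]; have [y [t [_ _ /(_ _ opt0)]]] := H I CI.
move=> [S [_ _ le]]; rewrite -(pmulr_lge0 alpha (x := ratr (cost S0))) ?ltr0q //.
by apply: le_trans le; rewrite ler0q.
Qed.

Lemma ufl_ratio_ge0 (R : realFieldType) (rho : R) A :
  approx_algorithm UFL metric_instance rho A -> 0 <= rho.
Proof.
have [|S optS] := @ufl_optimal_exists unit_instance
    (UflSolution (I := unit_instance) setT (fun=> ord0)).
  by move=> j; rewrite inE.
apply: approx_ratio_ge0 (@ufl_cost_ge0 _) metric_unit_instance optS _.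
by rewrite /= big1 // big_ord1.
Qed.

Lemma mlufl_ratio_ge0 (R : realFieldType) (gamma : R) B :
  approx_algorithm uniform_MLUFL
    (fun I => metric_instance I /\ zero_facility_costs I) gamma B -> 0 <= gamma.
Proof.
have [|S optS] := @mlufl_optimal_exists unit_instance
    (MluflSolution (I := unit_instance) [:: ord0] (fun=> ord0)).
  by split=> // j; rewrite inE.
apply: approx_ratio_ge0 (@mlufl_cost_ge0 _) _ optS _.
  by split=> //; exact: metric_unit_instance.
by rewrite /= big1 // big_ord1 add0r ltr_pwDl.
Qed.

Definition dnonempty (x : data) : data :=
  if truthy (disnode (dfst x)) then disnode (dsnd x) else Leaf 0.

Lemma dnonemptyE I :
  truthy (dnonempty (enc_instance I)) = (0 < nfac I)%N && (0 < ncli I)%N.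
Proof.
have H s : truthy (disnode (dlist s)) = (0 < size s)%N by case: s.
rewrite /dnonempty /enc_instance [dfst _]/= [dsnd _]/= H size_map size_enum_ord.
by case: ifP => // _; rewrite H size_map size_enum_ord.
Qed.

Theorem theorem2p12 (R : realFieldType) (rho gamma : R) (A B : prog)
  (hA : approx_algorithm UFL metric_instance rho A)
  (hB : approx_algorithm uniform_MLUFL
          (fun I => metric_instance I /\ zero_facility_costs I) gamma B) :
  exists C : prog,
    approx_algorithm uniform_MLUFL metric_instance (rho + 2 * gamma) C.
Proof.
have rho0 := ufl_ratio_ge0 hA; have gamma0 := mlufl_ratio_ge0 hB.
have [pt [bt Ht]] : ptime dnonempty by rewrite /dnonempty; ptime.
have [pz [bz Hz]] := ptime_zero; have [pc [bc Hc]] := ptime_combine.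
have [pe [be He]] : ptime (fun=> Node (Leaf 0) (Leaf 0)) by ptime.
case: hA => bA HA; case: hB => bB HB.
exists (If pt (Seq (Pair (Prim PId) (Pair A (Seq pz B))) pc) pe).
(* The summands follow the run of the program. The argument of [bc] bounds the input of the
   combining stage: the instance, two encoded solutions and two pairing nodes. *)
have [b bP] : poly_bounded (fun n => n + bt.[n] +
    (n + n + (n + bA.[n] + (bz.[n] + bB.[bz.[n]])) +
     bc.[n + 2 * (2 * (n * (n + 3)) + 5) + 2]) + be.[n])%N by poly_bounded.
exists b => I metI; set x := enc_instance I.
have [tt rt lett] := Ht x.
case: (boolP (truthy (dnonempty x))) => [ne|empty]; last first.
  have [te re lee] := He x; exists (Node (Leaf 0) (Leaf 0)), (dsize x + tt + te)%N.
  split; first by apply: run_if rt _; rewrite (negbTE empty).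
    by apply: leq_trans (bP _); lia.
  (* Without facilities, the assignment of [S0] itself excludes clients. So there are no clients in
     either case, and the pair of empty lists encodes the empty path, of cost 0. *)
  move=> S0 _; have no_client (j : 'I_(ncli I)) : False.
    move: empty; rewrite dnonemptyE negb_and -!leqNgt !leqn0 => /orP[]/eqP z.
      by have := ltn_ord (mlufl_assign S0 j); rewrite {2}z.
    by have := ltn_ord j; rewrite {2}z.
  exists (MluflSolution [::] (mlufl_assign S0)); split=> //.
    rewrite /= /dassign; suff -> : enum 'I_(ncli I) = [::] by [].
    by case: (enum _) => // j _; case: (no_client j).
  rewrite /= big_nil add0r big1 ?rmorph0; last by move=> j; case: (no_client j).
  by rewrite mulr_ge0 ?ler0q ?mlufl_cost_ge0 // addr_ge0 // mulr_ge0.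
have := ne; rewrite dnonemptyE => /andP[n0 m0].
have [S1o opt1] : exists S : solution UFL I, optimal S.
  apply: (ufl_optimal_exists (S0 := UflSolution setT (fun=> Ordinal n0))).
  by move=> j; rewrite inE.
have [S2o opt2] : exists S : solution uniform_MLUFL (zero_instance I), optimal S.
  apply: (mlufl_optimal_exists (S0 := MluflSolution (I := zero_instance I)
    [:: Ordinal n0] (fun=> Ordinal n0))).
  by split=> // j; rewrite inE.
have [y1 [t1 [r1 le1 /(_ _ opt1) [S1 [y1E feas1 cost1]]]]] := HA I metI.
have [y2 [t2 [r2 le2 /(_ _ opt2) [S2 [y2E feas2 cost2]]]]] :=
  HB (zero_instance I) (conj (metric_zero_instance metI) (fun=> erefl)).
have [tz rz lez] := Hz x; rewrite dzeroE in rz lez.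
have [sigma near combE] := dcombineE S1 S2 m0.
have [tc rc lec] := Hc (Node x (Node y1 y2)).
rewrite {2}y1E {2}y2E combE in rc.
have sz1 := dsize_ufl_solution S1 (nfac_leq_dsize I) (ncli_leq_dsize I).
have sz2 := dsize_mlufl_solution feas2 (nfac_leq_dsize I) (ncli_leq_dsize I).
exists (enc_solution (combined S2 sigma)).
eexists; split.
- apply: run_if rt _; rewrite ne; apply: run_seq rc.
  apply: run_pair (run_prim _ _) _.
  by apply: run_pair r1 _; apply: run_seq rz r2.
- apply: leq_trans (bP _).
  have szz : (dsize (enc_instance (zero_instance I)) <= bz.[dsize x])%N by lia.
  have szc : (dsize (Node x (Node y1 y2)) <=
      dsize x + 2 * (2 * (dsize x * (dsize x + 3)) + 5) + 2)%N.
    move: sz1 sz2; rewrite -y1E -y2E -/x; clearbody x => /=.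
    by set K := (dsize x * (dsize x + 3))%N; lia.
  apply: leq_trans (leq_addr _ _); rewrite !leq_add //.
  + exact: leq_trans (leq_addr _ _) lett.
  + exact: leq_trans (leq_addr _ _) lez.
  + exact: leq_trans le2 (leq_horner bB szz).
  + exact: leq_trans (leq_trans (leq_addr _ _) lec) (leq_horner bc szc).
move=> S0 [feas0 opt0]; exists (combined S2 sigma); split=> //.
  exact: combined_feasible.
have [S1' feas1' le1'] := ufl_le_mlufl feas0.
have [S2' feas2' le2'] := mlufl_zero_le feas0.
have c1 : ratr (cost S1) <= rho * ratr (cost S0).
  apply: le_trans cost1 _; rewrite ler_wpM2l // ler_rat.
  by apply: le_trans le1'; case: opt1 => _; exact.
have c2 : ratr (cost S2) <= gamma * ratr (cost S0).
  apply: le_trans cost2 _; rewrite ler_wpM2l // ler_rat.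
  by apply: le_trans le2'; case: opt2 => _; exact.
have := combined_cost metI feas1 feas2 near; rewrite -(ler_rat R).
have -> : ratr (cost S1 + 2 * cost S2) = ratr (cost S1) + 2 * ratr (cost S2) :> R.
  by move: (cost S1) (cost S2) => u v; rewrite rmorphD rmorphM /= ratr_nat.
lra.
Qed.
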